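(* For any $H$-MBQC $\mathcal{M}$ with symmetry group $H$ and corresponding input group $Q=H/N$, the output function $o:Q\to\mathbb{Z}_2$ is specified by the symmetry condition $h(\mathcal{R}_o)=\mathcal{R}_o$ ($\forall h\in H$) up to an additive constant, namely $$o(q)=o(\mathrm{e})+\Phi_q(\partial_R f_{\rm e})\qquad\text{for all } q\in Q,$$ where $\mathrm{e}$ is the identity of $Q$ and $\Phi$ is the phase function on $Q$.
   Context: Observables. Fix a finite-dimensional Hilbert space. $\mathcal{O}$ is a set of observables (Hermitian operators with eigenvalues $\pm1$ only) with $A\in\mathcal{O}\Leftrightarrow -A\in\mathcal{O}$. A resolution of an observable $X$ in $\mathcal{O}$ is a product $X=A_1(A_2(\cdots(A_{K-1}A_K)))$, $K\ge 1$, $A_i\in\mathcal{O}$, such that with $B_i:=\prod_{l=i+1}^K A_l$ (in this order) $[A_i,B_i]=0$ for $i=1,\dots,K-1$. $\mathcal{I}$ is the set of all observables having a resolution in $\mathcal{O}$; it is closed under $A\mapsto -A$. $E$ is the set of classes $\{A,-A\}$, $A\in\mathcal{I}$; for each $a\in E$ a representative $T_a\in\mathcal{I}$ is fixed, so $\mathcal{I}=\{\pm T_a: a\in E\}$. $E_{\mathcal{O}}:=\{a\in E: T_a\in\mathcal{O}\}$. For $a\in E_{\mathcal{O}}$, $b\in E$ with $[T_a,T_b]=0$, $a\oplus b\in E$ is defined by $T_{a\oplus b}=\pm T_aT_b$. Chain complex (coefficients $\mathbb{Z}_2$). $C_1(E)$ is freely generated by $[a]$, $a\in E$; $C_2(E)$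 is freely generated by the pairs $[a|b]$ for which $a\oplus b$ is defined; $\partial[a|b]=[a]+[b]+[a\oplus b]$. For $E_0\subset E$, $C_n(E,E_0):=C_n(E)/C_n(E_0)$, where $C_n(E_0)$ is spanned by the generators all of whose edges lie in $E_0$; $\partial_R$ is the induced boundary. $C_1(E,E_0)$ has basis $E\setminus E_0$. Symmetry and input groups. $H$ is a group acting on the set $\mathcal{I}$ with $h(-A)=-h(A)$. The induced action on $E$ and the phase function $\tilde\Phi_h(a)\in\mathbb{Z}_2$ are defined by $h(T_a)=(-1)^{\tilde\Phi_h(a)}T_{ha}$; $\tilde\Phi_h$ is extended linearly to 1-chains. $N=\{n\in H: na=a\ \forall a\in E\}$, and the input group is $Q=H/N$, assumed finite, acting on $E$ by $[h]a=ha$. A sequence of distinct edges $a_1,\dots,a_n\in E_{\mathcal{O}}$ is fixed, $\mathcal{E}_{\rm e}=\{a_1,\dots,a_n\}$, such that $a_{\rm e}:=a_1\oplus(a_2\oplus\cdots\oplus(a_{n-1}\oplus a_n))$ is defined. $E_0:=\{qa_{\rm e}: q\in Q\}$, and $\mathcal{E}_{\rm e}\cap E_0=\emptyset$. With $b_i:=a_{i+1}\oplus(\cdots\oplus a_n)$ (so $b_{n-1}=a_n$), $f_{\rm e}$ is the image of $\sum_{i=1}^{n-1}[a_i|b_i]$ in $C_2(E,E_0)$; $\partial_R f_{\rm e}=\sum_i a_i$. For the output function $o:Q\to\mathbb{Z}_2$ let $\mathcal{R}_o:=\{(-1)^{o(q)}\prod_{i=1}^nT_{qa_i}: q\in Q\}$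 (products in the order $1,\dots,n$). There is $\chi:E_0\to\mathbb{Z}_2$ with $\mathcal{R}_o=\{(-1)^{\chi(x)}T_x: x\in E_0\}$. $H$ is required to satisfy, for all $h\in H$: (1) $h(A)\in\mathcal{O}$ for all $A\in\mathcal{O}$; (2) $h(A)h(B)=h(AB)$ for all $A,B\in\mathcal{I}$ with $[A,B]=0$ and $AB\in\mathcal{I}$; (3) the symmetry condition $h(\mathcal{R}_o)=\mathcal{R}_o$. In $\mathcal{M}$, on input $q$ the observables $T_{qa_1},\dots,T_{qa_n}$ are measured on a resource state and the sum mod 2 of the binary outcomes is output; $o$ is the intended output function (in general attained only with some probability). Phase function on $Q$. Let $\overline\chi$ be the extension of $\chi$ to $E$ by zero, and $(\Phi_\chi)_h(a):=\tilde\Phi_h(a)+\overline\chi(ha)+\overline\chi(a)$; it vanishes for $a\in E_0$, so it is defined on $C_1(E,E_0)$. Let $C_1(\mathcal{C}_Q)\subset C_1(E,E_0)$ be the span of the chains $q\,\partial_Rf_{\rm e}$, $q\in Q$. For $x\in C_1(\mathcal{C}_Q)$, $(\Phi_\chi)_h(x)$ depends on $h$ only through $[h]\in Q$, and one sets $\Phi_{[h]}(x):=(\Phi_\chi)_h(x)$. *)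

(* Defs.v *)
From HB Require Import structures.
From mathcomp Require Import all_boot all_order all_algebra.
From mathcomp Require Import generic_quotient ring_quotient.
From mathcomp Require Import sesquilinear spectral.
From mathcomp Require Import boolp classical_sets cardinality reals.
From mathcomp.real_closed Require Import complex.
From mathcomp Require Import finmap.
From mathcomp.multinomials Require Import monalg.

Set Implicit Arguments.
Unset Strict Implicit.
Unset Printing Implicit Defensive.

Import Order.TTheory GRing.Theory Num.Theory.

Local Open Scope classical_set_scope.
Local Open Scope quotient_scope.
Local Open Scope ring_scope.

(* Z_2 is 'F_2; sgn2 x is (-1)^x. *)
Definition sgn2 {K : pzRingType} (x : 'F_2) : K := (-1) ^+ (x : nat).

Section Chains.
Variable K : choiceType.

Definition lin_ext (V : lmodType 'F_2) (f : K -> V) (c : {malg 'F_2[K]}) : V :=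
  \sum_(k <- msupp c) c@_k *: f k.

(* The submodule spanned by the generators satisfying P, and the quotient of
   the free module by it. *)
Definition chains_in (P : {pred K}) : {pred {malg 'F_2[K]}} :=
  [pred c : {malg 'F_2[K]} | all (mem P) (msupp c)].

Lemma chains_in_zmod P : zmod_closed (chains_in P).
Proof.
split=> [|x y /allP hx /allP hy]; first by rewrite inE msupp0; apply/allP.
apply/allP => k kxy.
have := fsubsetP (msuppB_le x y) k kxy; rewrite in_fsetU => /orP[].
  exact: hx.
exact: hy.
Qed.

HB.instance Definition _ P :=
  GRing.isZmodClosed.Build {malg 'F_2[K]} (chains_in P) (chains_in_zmod P).

Definition rel_chains (P : {pred K}) := Quotient.quot (chains_in P).

End Chains.

Section Observables.
Variables (R : realType) (d : nat).

(* Operators on the Hilbert space C^(d+1); the zero space is excluded, since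
   there A = -A and signs are meaningless. *)
Local Notation M := 'M[R[i]]_d.+1.

Definition observable (A : M) : Prop :=
  A \is hermsymmx /\ forall z, eigenvalue A z -> z = 1 \/ z = -1.

(* With s = [:: A_1; ...; A_K], B_i is the ordered product over drop i s;
   nth counts from 0. *)
Definition is_resolution (O : set M) (s : seq M) (X : M) : Prop :=
  [/\ (0 < size s)%N,
      forall A, A \in s -> O A,
      forall i, (i.+1 < size s)%N ->
        GRing.comm (nth 0 s i) (\prod_(A <- drop i.+1 s) A) &
      X = \prod_(A <- s) A].

(* The set I of observables having a resolution in O. *)
Definition inferable (O : set M) : set M :=
  [set X | observable X /\ exists s, is_resolution O s X].

(* Edges are the two-element classes {A, -A} themselves. *)
Definition pm (A : M) : set M := [set A; - A].

Definition edges (O : set M) : set (set M) := [set pm A | A in inferable O].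

Definition edge (O : set M) := {x : set M | x \in edges O}.

HB.instance Definition _ O := Choice.on (edge O).

End Observables.

Section Complex.
Variables (R : realType) (d : nat).
Local Notation M := 'M[R[i]]_d.+1.
Variables (O : set M) (T : edge O -> M).

Definition edge_in (a : edge O) : Prop := O (T a).

Definition oplus_defined (a b : edge O) : Prop :=
  edge_in a /\ GRing.comm (T a) (T b).

(* The class {T_a T_b, - T_a T_b}. It is an edge when oplus_defined a b holds;
   the default value a is then not used. *)
Definition oplus (a b : edge O) : edge O := insubd a (pm (T a * T b)).

Definition C1 := {malg 'F_2[edge O]}.

Definition face := {p : edge O * edge O | `[< oplus_defined p.1 p.2 >]}.

HB.instance Definition _ := Choice.on face.

Definition C2 := {malg 'F_2[face]}.

(* The generator [a|b] of C2, and 0 if a (+) b is undefined. *)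
Definition gen2 (a b : edge O) : C2 :=
  if insub (a, b) is Some t then << (t : face) >> else 0.

Definition face_bd (t : face) : C1 :=
  << (val t).1 >> + << (val t).2 >> + << oplus (val t).1 (val t).2 >>.

Definition bd (c : C2) : C1 := lin_ext face_bd c.

Section Relative.
Variable E0 : set (edge O).

Definition edge_rel : {pred edge O} := mem E0.

Definition face_rel : {pred face} :=
  [pred t : face | [&& (val t).1 \in E0, (val t).2 \in E0
                     & oplus (val t).1 (val t).2 \in E0]].

Definition C1rel := rel_chains edge_rel.
Definition C2rel := rel_chains face_rel.

HB.instance Definition _ := GRing.Zmodule.on C1rel.
HB.instance Definition _ := GRing.Zmodule.on C2rel.

(* bd maps chains in E0 to chains in E0, so any representative will do. *)
Definition bdR (x : C2rel) : C1rel := \pi_C1rel (bd (repr x)).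

End Relative.

(* For a sequence a :: s = [:: a_1; ...; a_n] of edges, a nonempty sequence
   being given by its head and tail: a_1 (+) (a_2 (+) ... (+) a_n). *)
Fixpoint oplus_seq (a : edge O) (s : seq (edge O)) : edge O :=
  if s is b :: s' then oplus a (oplus_seq b s') else a.

Fixpoint oplus_seq_defined (a : edge O) (s : seq (edge O)) : Prop :=
  if s is b :: s'
  then oplus_defined a (oplus_seq b s') /\ oplus_seq_defined b s'
  else True.

(* The chain \sum_(1 <= i < n) [a_i|b_i], b_i = a_(i+1) (+) (... (+) a_n). *)
Fixpoint oplus_chain (a : edge O) (s : seq (edge O)) : C2 :=
  if s is b :: s' then gen2 a (oplus_seq b s') + oplus_chain b s' else 0.

Definition f_e (E0 : set (edge O)) (a : edge O) (s : seq (edge O)) : C2rel E0 :=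
  \pi_(C2rel E0) (oplus_chain a s).

End Complex.

Section Symmetry.
Variables (R : realType) (d : nat).
Local Notation M := 'M[R[i]]_d.+1.
Variable O : set M.
Variable H : groupType.

(* An action of H on the set I with h(-A) = -h(A); the values of act outside
   I are irrelevant. *)
Record signed_action := SignedAction {
  act :> H -> M -> M;
  act_inferable : forall h A, inferable O A -> inferable O (act h A);
  act_one : forall A, inferable O A -> act 1%g A = A;
  act_mul : forall g h A, inferable O A ->
    act (g * h)%g A = act g (act h A);
  act_opp : forall h A, inferable O A -> act h (- A) = - act h A
}.

Variable act : signed_action.

Lemma act_edge_subproof h (a : edge O) : act h @` val a \in edges O.
Proof.
case: a => x /= /set_mem[A IA <-]; apply/mem_set.
exists (act h A); first exact: act_inferable.
apply/seteqP; split=> [B [->|->]|B [C [->|->] <-]].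
- by exists A => //; left.
- by exists (- A); [right|exact: act_opp].
- by left.
- by right; exact: act_opp.
Qed.

(* h {A, -A} = {hA, -hA}, independently of a choice of representatives. *)
Definition act_edge (h : H) (a : edge O) : edge O :=
  exist _ (act h @` val a) (act_edge_subproof h a).

Lemma act_edge1 a : act_edge 1%g a = a.
Proof.
apply/val_inj => /=; case: a => x /= /set_mem[A IA <-].
apply/seteqP; split=> [B [C [->|->] <-]|B [->|->]].
- by left; rewrite act_one.
- by right; rewrite act_opp // act_one.
- by exists A; [left|rewrite act_one].
- by exists (- A); [right|rewrite act_opp // act_one].
Qed.

Lemma act_edgeM g h a : act_edge (g * h)%g a = act_edge g (act_edge h a).
Proof.
apply/val_inj => /=; case: a => x /= /set_mem[A IA <-].
have Ih := act_inferable act h IA.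
have eN : act (g * h)%g (- A) = act g (act h (- A)).
  by rewrite !act_opp // act_mul.
apply/seteqP; split=> [B [C [->|->] <-]|B [C' [C [->|->] <-] <-]].
- by exists (act h A); [exists A => //; left|rewrite act_mul].
- by exists (act h (- A)); [exists (- A) => //; right|].
- by exists A; [left|rewrite act_mul].
- by exists (- A); [right|].
Qed.

Definition N : set H := [set n | forall a, act_edge n a = a].

Lemma N1 : N 1%g. Proof. exact: act_edge1. Qed.

Lemma NM g h : N g -> N h -> N (g * h)%g.
Proof. by move=> Ng Nh a; rewrite act_edgeM Nh Ng. Qed.

Lemma NV g : N g -> N (g^-1)%g.
Proof. by move=> Ng a; rewrite -{1}[a]Ng -act_edgeM mulVg act_edge1. Qed.

Lemma NJ g h : N g -> N (h^-1 * g * h)%g.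
Proof. by move=> Ng a; rewrite !act_edgeM Ng -act_edgeM mulVg act_edge1. Qed.

Definition coset_rel : rel H := fun g h => `[< N (g^-1 * h)%g >].

Lemma coset_rel_equiv : equiv_class_of coset_rel.
Proof.
have sym x y : coset_rel x y -> coset_rel y x.
  by move=> /asboolP /NV; rewrite invgM invgK => Nyx; apply/asboolP.
split=> [x|x y|y x z /asboolP xy /asboolP yz].
- by apply/asboolP; rewrite mulVg; exact: N1.
- by apply/idP/idP; exact: sym.
- by apply/asboolP; have := NM xy yz; rewrite mulgA mulgK.
Qed.

Canonical coset_equiv := EquivRelPack coset_rel_equiv.
Canonical coset_encModRel := defaultEncModRel coset_rel.

(* The quotient group H/N, whose projection is \pi. *)
Definition Q := {eq_quot coset_rel}.

HB.instance Definition _ : EqQuotient H coset_rel Q := EqQuotient.on Q.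
HB.instance Definition _ := Choice.on Q.

Lemma pi_eqP (g h : H) : reflect (N (g^-1 * h)%g) (g == h %[mod Q]).
Proof. by rewrite piE; exact: asboolP. Qed.

Definition Q_one : Q := \pi_Q 1%g.
Definition Q_mul (x y : Q) : Q := \pi_Q (repr x * repr y)%g.
Definition Q_inv (x : Q) : Q := \pi_Q ((repr x)^-1)%g.

Lemma N_repr (h : H) : N ((repr (\pi_Q h))^-1 * h)%g.
Proof. by apply/pi_eqP; rewrite reprK. Qed.

Lemma Q_mulE g h : Q_mul (\pi_Q g) (\pi_Q h) = \pi_Q (g * h)%g.
Proof.
apply/eqP/pi_eqP; rewrite invgM.
have Ng := NJ h (N_repr g); have Nh := N_repr h.
set a := repr (\pi_Q g) in Ng *; set b := repr (\pi_Q h) in Nh *.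
suff -> : (b^-1 * a^-1 * (g * h) = (b^-1 * h) * (h^-1 * (a^-1 * g) * h))%g.
  exact: NM.
by rewrite !mulgA mulgK.
Qed.

Lemma Q_invE g : Q_inv (\pi_Q g) = \pi_Q (g^-1)%g.
Proof.
apply/eqP/pi_eqP.
have := NJ g^-1%g (N_repr g); rewrite invgK mulgA mulgK => /NV.
by rewrite invgM.
Qed.

Lemma Q_mulA : associative Q_mul.
Proof.
elim/quotW=> x; elim/quotW=> y; elim/quotW=> z.
by rewrite [Q_mul (\pi y) _]Q_mulE [Q_mul (\pi x) (\pi y)]Q_mulE !Q_mulE mulgA.
Qed.

Lemma Q_mul1 : left_id Q_one Q_mul.
Proof. by elim/quotW=> x; rewrite Q_mulE mul1g. Qed.

Lemma Q_mulr1 : right_id Q_one Q_mul.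
Proof. by elim/quotW=> x; rewrite Q_mulE mulg1. Qed.

Lemma Q_mulV : left_inverse Q_one Q_inv Q_mul.
Proof. by elim/quotW=> x; rewrite Q_invE Q_mulE mulVg. Qed.

Lemma Q_mulrV : right_inverse Q_one Q_inv Q_mul.
Proof. by elim/quotW=> x; rewrite Q_invE Q_mulE mulgV. Qed.

HB.instance Definition _ := isGroup.Build Q
  Q_mulA Q_mul1 Q_mulr1 Q_mulV Q_mulrV.
End Symmetry.

Section Phases.
Variables (R : realType) (d : nat).
Local Notation M := 'M[R[i]]_d.+1.
Variables (O : set M) (T : edge O -> M).
Variables (H : groupType) (act : signed_action O H).

Definition act_Q (q : Q act) (a : edge O) : edge O := act_edge act (repr q) a.

Lemma act_QE h a : act_Q (\pi h) a = act_edge act h a.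
Proof.
by rewrite /act_Q -[X in act_edge _ _ X = _](N_repr act h a) -act_edgeM mulVKg.
Qed.

Definition orbit_Q (a : edge O) : set (edge O) :=
  [set act_Q q a | q in [set: Q act]].

(* The signed products (-1)^(o q) T_(q a_1) ... T_(q a_n), q in Q. *)
Definition outputs (o : Q act -> 'F_2) (s : seq (edge O)) : set M :=
  [set sgn2 (o q) *: \prod_(a <- s) T (act_Q q a) | q in [set: Q act]].

(* h(T_a) = (-1)^(phase h a) T_(ha). *)
Definition phase (h : H) (a : edge O) : 'F_2 :=
  if act h (T a) == T (act_edge act h a) then 0 else 1.

Variables (E0 : set (edge O)) (chi : E0 -> 'F_2).

Definition ext0 (a : edge O) : 'F_2 := if insub a is Some x then chi x else 0.

Definition phase_chi (h : H) (a : edge O) : 'F_2 :=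
  phase h a + ext0 (act_edge act h a) + ext0 a.

(* When h permutes the signed operators (-1)^(chi x) T_x, x in E0, phase_chi h
   vanishes on E0, so the value does not depend on the representative. *)
Definition phase_rel (h : H) (x : C1rel E0) : 'F_2 :=
  lin_ext (phase_chi h : edge O -> ('F_2)^o) (repr x).

(* Meant for x in the span C_1(C_Q) of the chains q (bdR f_e), where
   phase_rel h x depends only on the class of h in Q. *)
Definition phase_Q (q : Q act) (x : C1rel E0) : 'F_2 := phase_rel (repr q) x.

End Phases.

(* Main.v *)
(* Put X_q = T_(q a_1) ... T_(q a_n). Since X_q = +- T_(q a_e), the element of
   R_o indexed by q is (-1)^(o q) X_q = (-1)^(chi (q a_e)) T_(q a_e), and as
   distinct edges have distinct classes {A, -A}, the symmetry condition forces
   h to map (-1)^(chi x) T_x to (-1)^(chi (h x)) T_(h x) for every x in E0.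
   Hence phase_chi h vanishes on E0, and h, acting on (-1)^(o e) X_e, gives
   (-1)^(o q) X_q for q = [h]. On the other hand h is multiplicative along the
   nested commuting product X_e, so h X_e = (-1)^(\sum_i phase h a_i) X_q.
   Comparing exponents gives the formula, because the boundary of f_e telescopes
   to \sum_i [a_i] modulo E0 and chi does not contribute at the a_i. *)
Require Import Defs.
From HB Require Import structures.
From mathcomp Require Import all_boot all_order all_algebra.
From mathcomp Require Import generic_quotient ring_quotient.
From mathcomp Require Import sesquilinear spectral.
From mathcomp Require Import boolp classical_sets cardinality reals.
From mathcomp.real_closed Require Import complex.
From mathcomp Require Import finmap.
From mathcomp.multinomials Require Import monalg.

Set Implicit Arguments.
Unset Strict Implicit.
Unset Printing Implicit Defensive.

Import Order.TTheory GRing.Theory Num.Theory.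

Local Open Scope classical_set_scope.
Local Open Scope ring_scope.

(** * Arithmetic and signs over ['F_2] *)

Lemma F2_eq01 (x : 'F_2) : x = 0 \/ x = 1.
Proof. by case: x => -[|[|//]] ?; [left|right]; apply: val_inj. Qed.

Lemma addF2 (x : 'F_2) : x + x = 0.
Proof. by case: (F2_eq01 x) => ->; apply: val_inj. Qed.

Lemma addr_cancel2 (V : zmodType) (x c y z : V) :
  c + c = 0 -> x + c + y + (z + c) = x + z + y.
Proof.
move=> c2; rewrite [z + c]addrC -addrA [y + _]addrCA -addrA [c + (c + _)]addrA.
by rewrite c2 add0r [y + z]addrC addrA.
Qed.

Section Sign.
Variable K : pzRingType.

Lemma sgn2_0 : sgn2 0 = 1 :> K. Proof. by []. Qed.
Lemma sgn2_1 : sgn2 1 = -1 :> K. Proof. by rewrite /sgn2 expr1. Qed.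

Lemma sgn2D (x y : 'F_2) : sgn2 (x + y) = sgn2 x * sgn2 y :> K.
Proof.
by case: (F2_eq01 x) => ->; case: (F2_eq01 y) => ->;
  rewrite ?add0r ?addr0 ?addF2 ?sgn2_0 ?sgn2_1 ?mul1r ?mulr1 ?mulrNN ?mulr1.
Qed.

End Sign.

Lemma sgn2_inj (K : numDomainType) : injective (sgn2 : 'F_2 -> K).
Proof.
move=> x y /eqP.
case: (F2_eq01 x) => ->; case: (F2_eq01 y) => -> //; rewrite sgn2_0 sgn2_1.
  by rewrite eq_sym eqNr oner_eq0.
by rewrite eqNr oner_eq0.
Qed.

(** * Linear extension and its descent to relative chains *)

Section LinExt.
Variables (K : choiceType) (V : lmodType 'F_2) (f : K -> V).
Implicit Types c : {malg 'F_2[K]}.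

Lemma lin_extEw (D : {fset K}) c : (msupp c `<=` D)%fset ->
  lin_ext f c = \sum_(k <- D) c@_k *: f k.
Proof.
move=> cD; rewrite /lin_ext (big_fset_incl _ cD) // => k _ kc.
by rewrite mcoeff_outdom // scale0r.
Qed.

Lemma lin_extD c1 c2 : lin_ext f (c1 + c2) = lin_ext f c1 + lin_ext f c2.
Proof.
rewrite (lin_extEw (msuppD_le c1 c2)).
rewrite (lin_extEw (fsubsetUl (msupp c1) (msupp c2))).
rewrite (lin_extEw (fsubsetUr (msupp c1) (msupp c2))) -big_split /=.
by apply: eq_bigr => k _; rewrite mcoeffD scalerDl.
Qed.

Lemma lin_ext0 : lin_ext f 0 = 0.
Proof. by rewrite /lin_ext msupp0 big_seq_fset0. Qed.

Lemma lin_extU k : lin_ext f << k >> = f k.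
Proof.
by rewrite (lin_extEw msuppU_le) big_seq_fset1 mcoeffUU scale1r.
Qed.

Lemma lin_ext_sumU (r : seq K) :
  lin_ext f (\sum_(k <- r) << k >>) = \sum_(k <- r) f k.
Proof.
elim: r => [|k r IH]; first by rewrite !big_nil lin_ext0.
by rewrite !big_cons lin_extD IH lin_extU.
Qed.

(** Coefficients are 0 or 1, so a chain is a plain sum of generators and additive closure of [W]
    suffices. *)
Lemma lin_ext_chains_in (P : {pred K}) (W : V -> Prop) c :
  W 0 -> (forall x y, W x -> W y -> W (x + y)) ->
  (forall k, k \in P -> W (f k)) -> c \in chains_in P -> W (lin_ext f c).
Proof.
move=> W0 WD Wf /allP cP; rewrite /lin_ext big_seq_cond.
apply: (big_ind W) => // k /andP[/cP/Wf Wk _].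
by case: (F2_eq01 c@_k) => ->; rewrite ?scale0r ?scale1r.
Qed.

End LinExt.

Lemma addMalgF2 (K : choiceType) (c : {malg 'F_2[K]}) : c + c = 0.
Proof. by apply/malgP => k; rewrite mcoeffD addF2 mcoeff0. Qed.

Lemma chains_inU (K : choiceType) (P : {pred K}) k :
  k \in P -> (<< k >> : {malg 'F_2[K]}) \in chains_in P.
Proof.
move=> kP; apply/allP => x /(fsubsetP msuppU_le).
by rewrite inE => /eqP ->.
Qed.

Lemma rel_chains_reprB (K : choiceType) (P : {pred K}) (c : {malg 'F_2[K]}) :
  repr (\pi_(rel_chains P)%qT c) - c \in chains_in P.
Proof.
by rewrite Quotient.idealrBE; apply/eqP; rewrite reprK.
Qed.

(** Two representatives differ by a chain in [P], which the extension of [f] kills. *)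
Lemma lin_ext_repr (K : choiceType) (V : lmodType 'F_2) (f : K -> V)
  (P : {pred K}) (c : {malg 'F_2[K]}) : (forall k, k \in P -> f k = 0) ->
  lin_ext f (repr (\pi_(rel_chains P)%qT c)) = lin_ext f c.
Proof.
move=> fP; have := rel_chains_reprB P c; set r := repr _ => rc.
rewrite -[r](subrK c) lin_extD.
suff -> : lin_ext f (r - c) = 0 by rewrite add0r.
apply: (lin_ext_chains_in (W := fun x => x = 0) _ _ fP rc) => //.
by move=> x y -> ->; rewrite addr0.
Qed.

(** * Observables as Hermitian involutions *)

Section Observable.
Variables (R : realType) (d : nat).
Local Notation M := 'M[R[i]]_d.+1.
Implicit Types A B : M.

Lemma hermsymmxP A : reflect (A = map_mx Num.conj A^T) (A \is hermsymmx).
Proof.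
by apply: (iffP (is_hermitianmxP _ _ _)); rewrite expr0 scale1r.
Qed.

(** By the spectral theorem [A] is diagonalisable; the diagonal entries are eigenvalues, hence of
    square 1. *)
Lemma observable_sqr A : observable A -> A * A = 1.
Proof.
move=> [/hermitian_normalmx/orthomx_spectralP].
set P := spectralmx A; set D := spectral_diag A => AE eigA.
have Pu : P \in unitmx by exact: spectral_unit.
have D2 j : D 0 j * D 0 j = 1.
  have : eigenvalue A (D 0 j).
    apply/eigenvalueP; exists (row j P).
      rewrite {1}AE -row_mul !mulmxA mulmxV // mul1mx row_mul row_diag_mx.
      by rewrite -scalemxAl -rowE.
    apply/eqP => Pj0; have : row j P *m invmx P = 0 by rewrite Pj0 mul0mx.
    rewrite -row_mul mulmxV // => /matrixP/(_ 0 j).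
    by rewrite !mxE eqxx => /eqP; rewrite oner_eq0.
  by move=> /eigA[->|->]; rewrite ?mulrNN mulr1.
rewrite -[A * A]/(A *m A) AE -!mulmxA mulKVmx // [diag_mx D *m (_ *m _)]mulmxA.
suff -> : diag_mx D *m diag_mx D = 1%:M by rewrite mul1mx mulVmx.
apply/matrixP => j k; rewrite mul_diag_mx !mxE.
by case: eqP => [->|]; rewrite ?mulr1n ?mulr0n ?mulr0 ?D2.
Qed.

Lemma observable_involution A : A \is hermsymmx -> A * A = 1 -> observable A.
Proof.
move=> hA A2; split=> // z /eigenvalueP[v vA v0].
have : z ^+ 2 *: v = v.
  by rewrite expr2 -scalerA -vA scalemxAl -vA -mulmxA [A *m A]A2 mulmx1.
move/eqP; rewrite -subr_eq0 -[X in _ - X]scale1r -scalerBl scaler_eq0.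
by rewrite (negPf v0) orbF subr_eq0 sqrf_eq1 => /orP[] /eqP ->; [left|right].
Qed.

Lemma observableN A : observable A -> observable (- A).
Proof.
move=> oA; apply: observable_involution; last by rewrite mulrNN observable_sqr.
case: oA => /hermsymmxP hA _; apply/hermsymmxP.
by rewrite {1}hA linearN /= map_mxN.
Qed.

Lemma observableM A B :
  observable A -> observable B -> GRing.comm A B -> observable (A * B).
Proof.
move=> oA oB cAB; apply: observable_involution; last first.
  rewrite {1}cAB mulrA -[B * A * A]mulrA observable_sqr // mulr1.
  exact: observable_sqr.
case: oA => /hermsymmxP hA _; case: oB => /hermsymmxP hB _.
by apply/hermsymmxP; rewrite -[A * B]/(A *m B) trmx_mul map_mxM -hA -hB.
Qed.

(** Multiplying by [A] gives scalar matrices, compared at entry (0, 0), which exists since the size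
    is [d.+1]. *)
Lemma sgn2_scale_inj A (x y : 'F_2) :
  observable A -> sgn2 x *: A = sgn2 y *: A -> x = y.
Proof.
move=> /observable_sqr A2 /(congr1 ( *%R^~ A)); rewrite -!scalerAl A2.
by move=> /matrixP/(_ 0 0); rewrite !mxE !mulr1 => /sgn2_inj.
Qed.

Lemma sgn2_pm A (e : 'F_2) : pm A (sgn2 e *: A).
Proof.
by case: (F2_eq01 e) => ->; [left; rewrite sgn2_0 scale1r
                            |right; rewrite sgn2_1 scaleN1r].
Qed.

Lemma pm_sgn2 A B : pm A B -> exists e : 'F_2, B = sgn2 e *: A.
Proof.
by case=> ->; [exists 0; rewrite sgn2_0 scale1r
              |exists 1; rewrite sgn2_1 scaleN1r].
Qed.

Lemma pm_eq A B : pm A B -> pm A = pm B.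
Proof.
by case=> ->; [|apply/seteqP; split=> C [->|->]; rewrite /pm /= ?opprK; auto].
Qed.

End Observable.

(** * Inferable observables and edge classes *)

Section Inferable.
Variables (R : realType) (d : nat).
Local Notation M := 'M[R[i]]_d.+1.
Variable O : set M.
Hypothesis O_observable : forall A, O A -> observable A.
Hypothesis O_opp : forall A, O A <-> O (- A).
Implicit Types A B : M.

Lemma inferableN A : inferable O A -> inferable O (- A).
Proof.
case=> /observableN oA [[|A1 s] [//= _ sO sC AE]]; split=> //.
exists (- A1 :: s); split=> //.
- move=> B; rewrite inE => /orP[/eqP ->|Bs].
    by apply/O_opp; rewrite opprK; apply: sO; rewrite mem_head.
  by apply: sO; rewrite inE Bs orbT.
(* Only the condition at index 0 involves the negated first factor. *)
- case=> [|i] lti; last exact: sC i.+1 lti.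
  rewrite /= drop0; apply/commr_sym/commrN/commr_sym.
  by have := sC 0%N lti; rewrite /= drop0.
- by rewrite AE !big_cons mulNr.
Qed.

(** Prepending [A] to a resolution of [B] adds a single commutation condition, namely that of [A]
    with [B]. *)
Lemma inferableM A B :
  O A -> inferable O B -> GRing.comm A B -> inferable O (A * B).
Proof.
move=> OA [oB [s [s0 sO sC BE]]] cAB; split.
  exact: observableM (O_observable OA) oB cAB.
exists (A :: s); split=> //.
- by move=> C; rewrite inE => /orP[/eqP ->|/sO].
- case=> [|i] lti; last exact: sC.
  by rewrite /= drop0 -BE.
- by rewrite big_cons BE.
Qed.

Lemma edge_inferable (a : edge O) A : val a A -> inferable O A.
Proof.
by case: a => x /= /set_mem[B IB <-] [->|->] //; exact: inferableN.
Qed.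

Lemma edgeE (a : edge O) A : val a A -> val a = pm A.
Proof. by case: a => x /= /set_mem[B IB <-] /pm_eq. Qed.

Lemma edge_eq (a b : edge O) A : val a A -> val b A -> a = b.
Proof. by move=> /edgeE aA /edgeE bA; apply: val_inj; rewrite aA bA. Qed.

Lemma edge_sgn2 (a : edge O) A (e : 'F_2) : val a A -> val a (sgn2 e *: A).
Proof. by move=> /edgeE ->; exact: sgn2_pm. Qed.

Lemma edge_sgn2_eq (a b : edge O) A B (x y : 'F_2) :
  val a A -> val b B -> sgn2 x *: A = sgn2 y *: B -> a = b.
Proof.
move=> /(edge_sgn2 x) aA /(edge_sgn2 y) bB AB.
by apply: edge_eq aA _; rewrite AB.
Qed.

(** * Nested sums of edges and their boundary *)

Section Edges.
Variable T : edge O -> M.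
Hypothesis T_repr : forall a : edge O, val a (T a).

Lemma T_inferable a : inferable O (T a).
Proof. exact: edge_inferable (T_repr a). Qed.

Lemma val_oplus a b : oplus_defined T a b -> val (oplus T a b) = pm (T a * T b).
Proof.
move=> [aO cab]; rewrite /oplus insubdK //; apply/mem_set.
by exists (T a * T b) => //; apply: inferableM => //; exact: T_inferable.
Qed.

Lemma oplus_seq_prod a s : oplus_seq_defined T a s ->
  val (oplus_seq T a s) (\prod_(b <- a :: s) T b).
Proof.
elim: s a => [|b s IH] a; first by rewrite big_seq1 => _; exact: T_repr.
case=> ab /IH; rewrite [X in _ -> val _ X]big_cons (edgeE (T_repr _)).
move=> /pm_sgn2[e ->].
by rewrite val_oplus // -scalerAr; exact: sgn2_pm.
Qed.

(** Definedness concerns the representative of the inner sum; the actual product differs from it by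
    a sign only. *)
Lemma oplus_seq_comm a b s : oplus_seq_defined T a (b :: s) ->
  GRing.comm (T a) (\prod_(c <- b :: s) T c).
Proof.
case=> -[_ cab] /oplus_seq_prod; rewrite (edgeE (T_repr _)) => /pm_sgn2[e ->].
by rewrite /GRing.comm -scalerAr cab -scalerAl.
Qed.

Lemma bd_gen2 a b : oplus_defined T a b ->
  bd (gen2 T a b) = << a >> + << b >> + << oplus T a b >>.
Proof.
move=> /asboolP ab; rewrite /bd /gen2.
case: insubP => [t _ tE|]; last by rewrite ab.
by rewrite lin_extU /face_bd tE.
Qed.

Lemma bdD (c1 c2 : C2 T) : bd (c1 + c2) = bd c1 + bd c2.
Proof. exact: lin_extD. Qed.

(** The sum of the tail arises from the first face and, by induction, from the remaining chain, so
    it cancels modulo 2. For a single edge the chain is 0 and the two terms on the right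
    coincide. *)
Lemma bd_oplus_chain a s : oplus_seq_defined T a s ->
  bd (oplus_chain T a s) = \sum_(b <- a :: s) << b >> + << oplus_seq T a s >>.
Proof.
elim: s a => [|b s IH] a /=; first by rewrite big_seq1 addMalgF2 /bd lin_ext0.
case=> ab /IH bs; rewrite bdD bs (bd_gen2 ab).
rewrite [in RHS]big_cons.
exact: addr_cancel2 (addMalgF2 _).
Qed.

Lemma bd_chains_in (E0 : set (edge O)) (c : C2 T) :
  c \in chains_in (@face_rel _ _ O T E0) -> bd c \in chains_in (edge_rel E0).
Proof.
apply: (lin_ext_chains_in (W := fun x => x \in chains_in (edge_rel E0))).
- exact: rpred0.
- by move=> x y; exact: rpredD.
- move=> t /and3P[t1 t2 t3].
  exact: rpredD (rpredD (chains_inU t1) (chains_inU t2)) (chains_inU t3).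
Qed.

Lemma bdR_piE (E0 : set (edge O)) (c : C2 T) :
  bdR (\pi_(C2rel T E0)%qT c) = \pi_(C1rel E0)%qT (bd c).
Proof.
rewrite /bdR; apply/eqP; rewrite -Quotient.idealrBE.
have := bd_chains_in (rel_chains_reprB (@face_rel _ _ O T E0) c).
set r := repr _ => rc.
by rewrite -{1}[r](subrK c) bdD addrK.
Qed.

(** * The symmetry action on products of representatives *)

Section Action.
Variables (H : groupType) (act : signed_action O H).

Lemma act_edge_val h (a : edge O) A :
  val a A -> val (act_edge act h a) (act h A).
Proof. by exists A. Qed.

(** The image lies in a two-element class, so if it is not the representative it is its negative. *)
Lemma act_phase h a :
  act h (T a) = sgn2 (phase T act h a) *: T (act_edge act h a).
Proof.
rewrite /phase; case: eqP => [->|neT]; first by rewrite sgn2_0 scale1r.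
have := act_edge_val h (T_repr a).
by rewrite (edgeE (T_repr _)) sgn2_1 scaleN1r => -[].
Qed.

Lemma act_sgn2 h (e : 'F_2) A : inferable O A ->
  act h (sgn2 e *: A) = sgn2 e *: act h A.
Proof.
by move=> IA; case: (F2_eq01 e) => ->;
  rewrite ?sgn2_0 ?sgn2_1 ?scale1r ?scaleN1r ?act_opp.
Qed.

Hypothesis act_prod : forall h A B, inferable O A -> inferable O B ->
  GRing.comm A B -> inferable O (A * B) -> act h A * act h B = act h (A * B).

(** [act_prod] covers commuting pairs only, so the product is split at its head, where
    [oplus_seq_comm] applies. *)
Lemma act_prod_T h a s : oplus_seq_defined T a s ->
  act h (\prod_(b <- a :: s) T b) =
  sgn2 (\sum_(b <- a :: s) phase T act h b) *:
    \prod_(b <- a :: s) T (act_edge act h b).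
Proof.
elim: s a => [|b s IH] a abs; first by rewrite !big_seq1 act_phase.
have cab := oplus_seq_comm abs.
case: (abs) => -[aO _] bs; have Ibs := edge_inferable (oplus_seq_prod bs).
rewrite big_cons -act_prod //; [|exact: T_inferable|exact: inferableM].
rewrite (IH _ bs) act_phase [X in _ = sgn2 X *: _]big_cons sgn2D.
rewrite [\prod_(_ <- a :: _) _]big_cons.
by rewrite -scalerAl -scalerAr scalerA.
Qed.

Lemma act_oplus_seq_prod h a s : oplus_seq_defined T a s ->
  val (act_edge act h (oplus_seq T a s))
    (\prod_(b <- a :: s) T (act_edge act h b)).
Proof.
move=> as_def; have := act_edge_val h (oplus_seq_prod as_def).
(* Multiplying by the same sign a second time removes it. *)
rewrite act_prod_T // => /(edge_sgn2 (\sum_(b <- a :: s) phase T act h b)).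
by rewrite scalerA -sgn2D addF2 sgn2_0 scale1r.
Qed.

End Action.
End Edges.
End Inferable.

Theorem theorem6 (R : realType) (d : nat)
  (O : set 'M[R[i]]_d.+1)
  (O_observable : forall A, O A -> observable A)
  (O_opp : forall A, O A <-> O (- A))
  (T : edge O -> 'M[R[i]]_d.+1)
  (T_repr : forall a : edge O, val a (T a))
  (H : groupType) (act : signed_action O H)
  (Q_finite : finite_set [set: Q act])
  (a1 : edge O) (s : seq (edge O))
  (a_uniq : uniq (a1 :: s))
  (a_in : forall a : edge O, a \in a1 :: s -> edge_in T a)
  (a_e_defined : oplus_seq_defined T a1 s)
  (a_notin_E0 : forall a : edge O, a \in a1 :: s ->
     ~ orbit_Q act (oplus_seq T a1 s) a)
  (o : Q act -> 'F_2)
  (chi : orbit_Q act (oplus_seq T a1 s) -> 'F_2)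
  (chiP : outputs T o (a1 :: s) =
     [set sgn2 (chi x) *: T (val x) | x in setT])
  (act_O : forall h A, O A -> O (act h A))
  (act_prod : forall h A B, inferable O A -> inferable O B ->
     GRing.comm A B -> inferable O (A * B) ->
     act h A * act h B = act h (A * B))
  (act_outputs : forall h,
     act h @` outputs T o (a1 :: s) = outputs T o (a1 :: s)) :
  forall q : Q act,
    o q = o 1%g + phase_Q T chi q (bdR (f_e T _ a1 s)).
Proof.
set ae := oplus_seq T a1 s in a_notin_E0 chi chiP *; set E0 := orbit_Q act ae.
set e0 := ext0 chi.
have chiE x (xE : x \in E0) : chi (Sub x xE) = e0 x.
  by rewrite /e0 /ext0 insubT.
have E0_act h x : E0 x -> E0 (act_edge act h x).
  case=> q _ <-; exists (\pi_(Q act)%qT h * q)%g => //.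
  rewrite -[q]reprK; move: (repr q) => g; rewrite act_QE.
  by rewrite -[(_ * _)%g]/(Q_mul _ _) Q_mulE act_QE act_edgeM.
(* [chiP] only provides some [x] in [E0]; comparing classes identifies it as the image of [ae] under
   [q]. *)
have outE q : sgn2 (o q) *: \prod_(a <- a1 :: s) T (act_Q q a) =
              sgn2 (e0 (act_Q q ae)) *: T (act_Q q ae).
  have : outputs T o (a1 :: s)
      (sgn2 (o q) *: \prod_(a <- a1 :: s) T (act_Q q a)).
    by exists q.
  rewrite chiP => -[[x xE] _ /= eqx]; move: eqx; rewrite (chiE x) => eqx.
  have xq : x = act_Q q ae.
    by apply: edge_sgn2_eq (T_repr x) _ eqx; last exact: act_oplus_seq_prod.
  by rewrite -eqx xq.
(* The symmetry condition provides some [y] in [E0]; again its class determines it. *)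
have act_E0 h x : E0 x -> act h (sgn2 (e0 x) *: T x) =
    sgn2 (e0 (act_edge act h x)) *: T (act_edge act h x).
  move=> xE; have xE' := mem_set xE.
  have : (act h @` outputs T o (a1 :: s)) (act h (sgn2 (e0 x) *: T x)).
    exists (sgn2 (e0 x) *: T x) => //; rewrite chiP.
    by exists (Sub x xE') => //; rewrite chiE.
  rewrite act_outputs chiP => -[[y yE] _ /=]; rewrite (chiE y) => eqy.
  have IT := T_inferable O_opp T_repr x.
  have yx : y = act_edge act h x.
    move: eqy; rewrite act_sgn2 //.
    exact: edge_sgn2_eq (T_repr y) (act_edge_val _ _ (T_repr x)).
  by rewrite -eqy yx.
have T_inj x (u v : 'F_2) : sgn2 u *: T x = sgn2 v *: T x -> u = v.
  by apply: sgn2_scale_inj; case: (T_inferable O_opp T_repr x).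
have phase_E0 h x : E0 x -> phase_chi T act chi h x = 0.
  move=> /(act_E0 h); rewrite act_sgn2; last exact: T_inferable.
  (* Equating exponents expresses [e0] at the image of [x] as [e0 x] plus the phase; after
     substitution every term of [phase_chi] occurs twice. *)
  rewrite act_phase // scalerA -sgn2D => /T_inj eqx.
  rewrite /phase_chi -/e0 -eqx [phase _ _ _ _ + _]addrC.
  by rewrite -[e0 x + _ + _]addrA addF2 addr0 addF2.
have e0_out a : ~ E0 a -> e0 a = 0.
  by move=> aE; rewrite /e0 /ext0 insubF //; apply/negP => /set_mem.
have E0_actV h x : E0 (act_edge act h x) -> E0 x.
  by move/(E0_act h^-1%g); rewrite -act_edgeM mulVg act_edge1.
have actQ1 a : act_Q (1%g : Q act) a = a.
  by rewrite -[1%g]/(Q_one act) act_QE act_edge1.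
have E0_ae : E0 ae by exists 1%g => //; rewrite actQ1.
move=> q; rewrite /phase_Q /phase_rel /f_e bdR_piE lin_ext_repr; last first.
  by move=> x /set_mem/phase_E0.
rewrite (bd_oplus_chain a_e_defined).
rewrite lin_extD lin_ext_sumU (lin_extU _ ae) (phase_E0 _ _ E0_ae) addr0.
set h := repr q.
(* Neither [a] nor, by [E0_actV], its image under [h] lies in [E0], so [e0] vanishes at both. *)
have -> : \sum_(a <- a1 :: s) phase_chi T act chi h a =
    \sum_(a <- a1 :: s) phase T act h a.
  apply: eq_big_seq => a /a_notin_E0 aE.
  by rewrite /phase_chi -/e0 !e0_out ?addr0 // => /E0_actV.
(* Apply [h] to the output at the identity: by [act_E0] and [outE] the right-hand side becomes the
   output at [q]. *)
have := outE 1%g; under eq_bigr => a _ do rewrite actQ1.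
rewrite actQ1 => /(congr1 (act h)); rewrite act_E0 // -/(act_Q q ae) -outE.
have X_e := oplus_seq_prod O_observable O_opp T_repr a_e_defined.
rewrite act_sgn2; last exact: edge_inferable X_e.
rewrite act_prod_T // scalerA -sgn2D.
(* Both sides are now multiples of one product; its unknown sign [e] relative to the representative
   enters both exponents and cancels. *)
have := act_oplus_seq_prod O_observable O_opp T_repr act_prod h a_e_defined.
rewrite -/ae (edgeE (T_repr _)) => /pm_sgn2[e ->].
by rewrite !scalerA -!sgn2D => /T_inj/addIr.
Qed.
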